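(* Let $\tilde\alpha,\tilde\beta:\mathbb{Q}^3\to\mathbb{Q}^3$ be the bijections $\tilde\alpha(x,y,z)=(x,z,xz-y)$ and $\tilde\beta(x,y,z)=(y,z,x)$, let $\widetilde G=\langle\tilde\alpha,\tilde\beta\rangle$, and let $\widetilde T(X,Y,Z)=XYZ-X^2-Y^2-Z^2-7$. Then the set of positive integer solutions of $\widetilde T(X,Y,Z)=0$ is exactly the orbit of $(3,4,4)$ under $\widetilde G$: $$\widetilde G(3,4,4)=\{(x,y,z)\in\mathbb{N}^3\mid \widetilde T(x,y,z)=0\}.$$
   Context: $\mathbb{N}$ denotes the positive integers; $\widetilde G(3,4,4)=\{\tilde g(3,4,4)\mid \tilde g\in\widetilde G\}$. *)

(* Defs.v *)
From mathcomp Require Import all_boot all_order all_algebra.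
From mathcomp Require Import classical_sets.
From mathcomp Require Import ring.

Set Implicit Arguments.
Unset Strict Implicit.
Unset Printing Implicit Defensive.

Import Order.TTheory GRing.Theory Num.Theory.
Local Open Scope classical_set_scope.
Local Open Scope ring_scope.

(* Subgroups of the symmetric group Sym(T) of a possibly infinite type T, whose
   elements are represented by the underlying functions T -> T. *)
Definition is_subgroup (T : Type) (H : set (T -> T)) : Prop :=
  [/\ forall f, H f -> bijective f,
      H id,
      forall f g, H f -> H g -> H (f \o g) &
      forall f g, H f -> cancel f g -> cancel g f -> H g].

(* The elements of S must be bijections: otherwise no subgroup contains S, and
   the intersection of the empty family of subgroups is the whole of T -> T. *)
Definition generated_group (T : Type) (S : set (T -> T)) : set (T -> T) :=
  smallest (@is_subgroup T) S.

Definition group_orbit (T : Type) (G : set (T -> T)) (x : T) : set T :=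
  [set g x | g in G].

Definition Q3 : Type := (rat * rat * rat)%type.

Definition alphat (p : Q3) : Q3 := let: (x, y, z) := p in (x, z, x * z - y).
Definition betat (p : Q3) : Q3 := let: (x, y, z) := p in (y, z, x).

Lemma alphat_bij : bijective alphat.
Proof.
exists (fun p : Q3 => let: (x, y, z) := p in (x, x * y - z, y)).
- by case=> [[x y] z] /=; congr (_, _, _); ring.
- by case=> [[x y] z] /=; congr (_, _, _); ring.
Qed.

Lemma betat_bij : bijective betat.
Proof.
by exists (fun p : Q3 => let: (x, y, z) := p in (z, x, y)); case=> [[x y] z].
Qed.

Definition Gt : set (Q3 -> Q3) := generated_group [set alphat; betat].

Definition Tt (x y z : rat) : rat :=
  x * y * z - x ^+ 2 - y ^+ 2 - z ^+ 2 - 7.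

Definition posint : set rat := [set x | x \is a Num.nat /\ 0 < x].

(* Main.v *)
Require Import Defs.
From mathcomp Require Import all_boot all_order all_algebra.
From mathcomp Require Import classical_sets.
From mathcomp Require Import ring zify.

Set Implicit Arguments.
Unset Strict Implicit.
Unset Printing Implicit Defensive.

Import Order.TTheory GRing.Theory Num.Theory.
Local Open Scope classical_set_scope.
Local Open Scope ring_scope.

(* Vieta descent.  With two coordinates fixed, the equation is a monic quadratic
   in the third, so z can be replaced by the other root x y - z, which is
   again a positive integer.  For a solution with x <= y <= z this shrinks the
   coordinate sum unless 2 z <= x y; in that case the quadratic is nonnegative
   at y, i.e. (x - 2) y^2 <= x^2 + 7, which leaves only (3, 4, 4).
   The group contains only the cyclic permutations, but alphat and betat are
   conjugated to their inverses by the swap of the last two coordinates, which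
   fixes (3, 4, 4); carrying both (x, y, z) and (x, z, y) through the descent
   therefore makes the coordinates freely permutable. *)

Section GeneratedGroup.

Variables (T : Type) (S : set (T -> T)).

Lemma generated_group_orbit_refl (x : T) :
  group_orbit (generated_group S) x x.
Proof. by exists id => // H [[_ Hid _ _] _]. Qed.

Lemma generated_group_orbit_step (x y : T) (f : T -> T) : S f ->
  group_orbit (generated_group S) x y ->
  group_orbit (generated_group S) x (f y).
Proof.
move=> Sf [g Gg <-]; exists (f \o g) => // H HS.
have [[_ _ Hcomp _] SH] := HS.
by apply: Hcomp; [exact: SH | exact: Gg].
Qed.

Lemma generated_group_orbit_unstep (x y : T) (f : T -> T) : S f ->
  bijective f -> group_orbit (generated_group S) x (f y) ->
  group_orbit (generated_group S) x y.
Proof.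
move=> Sf [f' fK f'K] [g Gg gx]; exists (f' \o g); last by rewrite /= gx fK.
move=> H HS; have [[_ _ Hcomp Hinv] SH] := HS.
by apply: Hcomp; [apply: Hinv fK f'K; exact: SH | exact: Gg].
Qed.

(** The bijections preserving [A] in both directions form a subgroup containing [S]; a mere
    implication would not be closed under inverses. *)
Lemma generated_group_invariant (A : set T) :
  (forall f, S f -> bijective f /\ forall x, A (f x) <-> A x) ->
  forall g x, generated_group S g -> A (g x) <-> A x.
Proof.
move=> SA g x Gg.
suff [_] : [set f : T -> T | bijective f /\ forall x, A (f x) <-> A x] g by apply.
apply: Gg; split=> //; split.
- by move=> f [].
- by split=> //; exists id.
- move=> f h [bf Af] [bh Ah]; split; first exact: bij_comp.
  by move=> y /=; rewrite Af Ah.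
- move=> f h [_ Af] fK hK; split; first by exists f.
  by move=> y; rewrite -[in X in _ <-> X](hK y) Af.
Qed.

End GeneratedGroup.

Definition positive_solution : set Q3 := [set p : Q3 | let: (x, y, z) := p in
  [/\ posint x, posint y, posint z & Tt x y z = 0]].

Lemma posint_vieta (x y z : rat) : posint x -> posint y -> posint z ->
  Tt x y z = 0 -> posint (x * z - y).
Proof.
move=> [xN x0] [yN y0] [zN z0] T0.
have pos : 0 < x * z - y.
  (* By Vieta the two roots in the middle coordinate have product [x^2 + z^2 + 7], which is
     positive. *)
  have : 0 < y * (x * z - y).
    have -> : y * (x * z - y) = Tt x y z + (x ^+ 2 + z ^+ 2 + 7).
      by rewrite /Tt; ring.
    by rewrite T0 add0r ltr_wpDl // addr_ge0 ?sqr_ge0.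
  by rewrite pmulr_rgt0.
split=> //; rewrite natrEint ltW // andbT.
by rewrite rpredB ?rpredM // intr_nat.
Qed.

Lemma alphat_positive_solution (p : Q3) :
  positive_solution (alphat p) <-> positive_solution p.
Proof.
case: p => [[x y] z]; rewrite /positive_solution /=.
have -> : Tt x z (x * z - y) = Tt x y z by rewrite /Tt; ring.
split=> -[hx hy hz T0]; split=> //; last exact: posint_vieta.
(* Taking the other root is an involution, so [posint_vieta] also applies backwards. *)
rewrite [y](_ : _ = x * z - (x * z - y)); last by ring.
by apply: posint_vieta => //; rewrite -T0 /Tt; ring.
Qed.

Lemma betat_positive_solution (p : Q3) :
  positive_solution (betat p) <-> positive_solution p.
Proof.
case: p => [[x y] z]; rewrite /positive_solution /=.
have -> : Tt y z x = Tt x y z by rewrite /Tt; ring.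
by split=> -[].
Qed.

Lemma Gt_positive_solution (g : Q3 -> Q3) (p : Q3) :
  Gt g -> positive_solution (g p) <-> positive_solution p.
Proof.
apply: generated_group_invariant => f [] ->; split.
- exact: alphat_bij.
- exact: alphat_positive_solution.
- exact: betat_bij.
- exact: betat_positive_solution.
Qed.

(** The squares stand on the right so that truncated subtraction never appears. *)
Definition natural_solution (x y z : nat) : Prop :=
  [/\ (0 < x)%N, (0 < y)%N, (0 < z)%N &
      (x * y * z = x * x + y * y + z * z + 7)%N].

Lemma reduced_natural_solution (x y z : nat) : natural_solution x y z ->
  (x <= y)%N -> (y <= z)%N -> (2 * z <= x * y)%N ->
  [/\ x = 3, y = 4 & z = 4]%N.
Proof.
move=> [x0 y0 z0 E] xy yz zxy.
have key : (x * y * y <= x * x + 2 * (y * y) + 7)%N.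
  have [d dE] : exists d, z = (y + d)%N by exists (z - y)%N; lia.
  subst z.
  (* For f the quadratic with root z, f(y) = f(y) - f(z) = d(xy - 2y - d), which is at least d^2
     since 2z <= xy. *)
  have : (d * (2 * (y + d)) <= d * (x * y))%N by rewrite leq_mul2l zxy orbT.
  nia.
have x3 : (x <= 3)%N.
  rewrite leqNgt; apply/negP => x4.
  (* Together with [key] this gives x^2 (x - 3) <= 7, impossible for x >= 4. *)
  have : (x * x * (x - 2) <= y * y * (x - 2))%N.
    by rewrite leq_mul2r leq_mul ?orbT.
  nia.
have [?|[?|?]] : (x = 1 \/ x = 2 \/ x = 3)%N by lia.
- by subst x; lia.
- subst x; have ? : z = y by lia.
  by subst z; lia.
(* Now [key] reads y^2 <= 16, and 2z <= 3y bounds z. *)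
- subst x; have y4 : (y <= 4)%N by nia.
  have [?|?] : (y = 3 \/ y = 4)%N by lia.
  + subst y; have z4 : (z <= 4)%N by lia.
    have [?|?] : (z = 3 \/ z = 4)%N by lia.
      by subst z; lia.
    by subst z; lia.
  + subst y; have : (z = 4 \/ z = 5 \/ z = 6)%N by lia.
    by case=> [->|[?|?]] //; subst z; lia.
Qed.

Lemma natural_solution_ind (P : nat -> nat -> nat -> Prop) :
  P 3%N 4%N 4%N ->
  (forall x y z, P x y z -> P x z y) ->
  (forall x y z, P x y z -> P y z x) ->
  (forall x y z, (z <= x * y)%N -> P x y (x * y - z)%N -> P x y z) ->
  forall x y z, natural_solution x y z -> P x y z.
Proof.
move=> P0 Pswap Pcycle Pvieta x y z.
have [n] := ubnP (x + y + z)%N.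
elim: n x y z => // n IHn x y z.
wlog xy : x y z / (x <= y)%N.
  move=> sorted; have [xy|yx] := leqP x y; first exact: sorted.
  move=> lt_n [x0 y0 z0 E]; apply/Pswap/Pcycle.
  by apply: sorted; [lia | lia | split=> //; lia].
wlog yz : x y z xy / (y <= z)%N.
  move=> sorted; have [yz|zy] := leqP y z; first exact: sorted.
  move=> lt_n [x0 y0 z0 E]; have [xz|zx] := leqP x z.
    by apply: Pswap; apply: sorted; [lia | lia | lia | split=> //; lia].
  apply: Pcycle; apply: sorted; [lia | lia | lia | by split=> //; lia].
move=> lt_n sol; have [le2z|lt2z] := leqP (2 * z) (x * y).
  by have [-> -> ->] := reduced_natural_solution sol xy yz le2z.
have [x0 y0 z0 E] := sol.
(* The equation forces z^2 < xyz, so the other root xy - z is positive; it is below z because xy <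
   2z. *)
have ltz : (z < x * y)%N by nia.
apply: Pvieta; first exact: ltnW.
apply: IHn; first by lia.
have [d dE] : exists d, (x * y = z + d)%N by exists (x * y - z)%N; lia.
by rewrite dE addKn; split=> //; [lia | nia].
Qed.

Lemma natural_solution_orbit (x y z : nat) : natural_solution x y z ->
  group_orbit Gt ((3, 4, 4) : Q3) (x%:R, y%:R, z%:R).
Proof.
pose O (a b c : nat) := group_orbit Gt ((3, 4, 4) : Q3) (a%:R, b%:R, c%:R).
have beta_step a b c : O a b c -> O b c a.
  exact: (@generated_group_orbit_step _ _ _ (_, _, _) betat (or_intror erefl)).
suff OO : natural_solution x y z -> O x y z /\ O x z y by move=> /OO [].
move: x y z; apply: (@natural_solution_ind (fun x y z => O x y z /\ O x z y)).
- by split; apply: generated_group_orbit_refl.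
- by move=> x y z [].
- by move=> x y z [Oxyz Oxzy]; split; [exact: beta_step | exact/beta_step/beta_step].
(* [alphat] sends (x, xy - z, y) to (x, y, z), a forward step, and (x, z, y) to (x, y, xy - z), a
   step to be undone. *)
- move=> x y z zxy [O1 O2]; split.
  + have := @generated_group_orbit_step _ _ _ _ alphat (or_introl erefl) O2.
    by rewrite /O /= natrB // natrM subKr.
  + apply: (@generated_group_orbit_unstep _ _ _ _ alphat (or_introl erefl)).
      exact: alphat_bij.
    by move: O1; rewrite /O /= natrB // natrM.
Qed.

Theorem theorem3p4 :
  group_orbit Gt ((3, 4, 4) : Q3) =
  [set p : Q3 | let: (x, y, z) := p in
     [/\ posint x, posint y, posint z & Tt x y z = 0]].
Proof.
rewrite -/positive_solution; apply/seteqP; split=> [_ [g Gg <-]|].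
  (* Invariance leaves only the numerical check at (3, 4, 4). *)
  by apply/Gt_positive_solution.
move=> [[x y] z] [[/natrP [a ->] a0] [/natrP [b ->] b0] [/natrP [c ->] c0] T0].
move: a0 b0 c0; rewrite !ltr0n => a0 b0 c0.
apply: natural_solution_orbit; split=> //; apply/eqP.
rewrite -(eqr_nat rat) !natrD !natrM -subr_eq0 -[X in _ == X]T0 /Tt.
by apply/eqP; ring.
Qed.
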